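(* Let $\xi(G,x,y,z)$ denote the unique function from finite multigraphs to $\mathbb{Z}[x,y,z]$ satisfying: $\xi(G)=\xi(G_{-e})+y\cdot\xi(G_{/e})+z\cdot\xi(G_{\dagger e})$ for every multigraph $G$ and every edge $e$ of $G$; $\xi(G_1\oplus G_2)=\xi(G_1)\xi(G_2)$; $\xi(E_1)=x$; $\xi(\emptyset)=1$. Then for every finite multigraph $G=(V,E)$, $$\xi(G,x,y,z)=\sum_{(A\sqcup B)\subseteq E} x^{k(A\sqcup B)-k_{cov}(B)}\, y^{|A|+|B|-k_{cov}(B)}\, z^{k_{cov}(B)}.$$
   Context: Multigraphs are finite, loops and multiple edges allowed. For an edge $e$: $G_{-e}$ removes $e$; $G_{/e}$ identifies the endpoints of $e$ (removing $e$; may create loops and multiple edges); $G_{\dagger e}$ is the subgraph induced by $V\setminus\{u,v\}$ where $e=\{u,v\}$. $G_1\oplus G_2$ is disjoint union, $E_1$ is the one-vertex edgeless graph, $\emptyset$ the graph with no vertices. For $S\subseteq E$, $V(S)$ is the set of vertices covered by (incident to) edges of $S$. The sum ranges over all pairs $(A,B)$ of subsets of $E$ with $V(A)\cap V(B)=\emptyset$ (written $A\sqcup B$). $k(A\sqcup B)$ is the number of connected components of the spanning subgraph $(V,A\cup B)$, and $k_{cov}(B)$ is the number of connected components of the graph $(V(B),B)$. *)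

(* Defs.v *)
From HB Require Import structures.
From mathcomp Require Import all_boot all_order all_algebra.
From mathcomp Require Import mpoly.

Set Implicit Arguments.
Unset Strict Implicit.
Unset Printing Implicit Defensive.

Import GRing.Theory.
Local Open Scope ring_scope.

(* [ends e] is the unordered set of endpoints of [e]: a singleton when [e] is
   a loop.  Multiple edges are distinct elements of [edge G] with equal ends. *)
Record mgraph : Type := MGraph {
  vert : finType;
  edge : finType;
  ends : edge -> {set vert};
  ends_card : forall e, (0 < #|ends e| <= 2)%N
}.

Definition mgraph_iso (G H : mgraph) : Prop :=
  exists (fv : vert G -> vert H) (fe : edge G -> edge H),
    [/\ bijective fv, bijective fe
      & forall e, ends (fe e) = [set fv u | u in ends e]].

Definition del_ends (G : mgraph) (e : edge G) (f : {f : edge G | f != e}) :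
  {set vert G} := ends (val f).

Lemma del_ends_card (G : mgraph) (e : edge G) f :
  (0 < #|@del_ends G e f| <= 2)%N.
Proof. exact: ends_card. Qed.

Definition del_edge (G : mgraph) (e : edge G) : mgraph :=
  MGraph (@del_ends_card G e).

(* In the contraction of [e], [None] is the vertex obtained by identifying the
   endpoints of [e], and [insub] is the quotient map on vertices: it sends the
   endpoints of [e] to [None] and every other vertex [w] to [Some w]. *)
Definition contract_vert (G : mgraph) (e : edge G) : finType :=
  option {w : vert G | w \notin ends e}.

Definition contract_ends (G : mgraph) (e : edge G)
    (f : {f : edge G | f != e}) : {set contract_vert e} :=
  [set (insub w : contract_vert e) | w in ends (val f)].

Lemma contract_ends_card (G : mgraph) (e : edge G) f :
  (0 < #|@contract_ends G e f| <= 2)%N.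
Proof.
have /andP[f_gt0 f_le2] := ends_card (val f).
rewrite (leq_trans (leq_imset_card _ _) f_le2) andbT.
case/card_gt0P: f_gt0 => w fw; apply/card_gt0P.
by exists (insub w); apply: imset_f.
Qed.

Definition contract_edge (G : mgraph) (e : edge G) : mgraph :=
  MGraph (@contract_ends_card G e).

Definition induced_ends (G : mgraph) (S : {set vert G})
    (f : {f : edge G | ends f \subset S}) : {set {w : vert G | w \in S}} :=
  [set w | val w \in ends (val f)].

Lemma induced_ends_card (G : mgraph) (S : {set vert G}) f :
  (0 < #|@induced_ends G S f| <= 2)%N.
Proof.
case: f => f fS.
have -> : #|@induced_ends G S (exist _ f fS)| = #|ends f|; last first.
  exact: ends_card.
rewrite -(card_imset _ val_inj); apply: eq_card => w.
apply/imsetP/idP => [[w'] | fw]; first by rewrite inE => ? ->.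
by exists (exist _ w (subsetP fS w fw)); rewrite ?inE.
Qed.

Definition induced (G : mgraph) (S : {set vert G}) : mgraph :=
  MGraph (@induced_ends_card G S).

Definition extract_edge (G : mgraph) (e : edge G) : mgraph :=
  induced (~: ends e).

Definition disj_ends (G H : mgraph) (f : edge G + edge H) :
    {set vert G + vert H} :=
  match f with
  | inl f1 => [set inl u | u in ends f1]
  | inr f2 => [set inr u | u in ends f2]
  end.

Lemma disj_ends_card (G H : mgraph) f : (0 < #|@disj_ends G H f| <= 2)%N.
Proof.
by case: f => f /=; rewrite card_imset ?ends_card //;
   [exact: inl_inj | exact: inr_inj].
Qed.

Definition disj_union (G H : mgraph) : mgraph := MGraph (@disj_ends_card G H).

Definition edgeless (V : finType) : mgraph :=
  @MGraph V void (fun e => match e with end) (fun e => match e with end).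

Definition E1 : mgraph := edgeless unit.
Definition empty_mgraph : mgraph := edgeless void.

Notation Zxyz := {mpoly int[3]}.
Definition Zx : Zxyz := 'X_(@Ordinal 3 0 isT).
Definition Zy : Zxyz := 'X_(@Ordinal 3 1 isT).
Definition Zz : Zxyz := 'X_(@Ordinal 3 2 isT).

(* Invariance under isomorphism expresses that [xi] is a function of
   multigraphs rather than of their presentations by particular finite types. *)
Record is_xi (xi : mgraph -> Zxyz) : Prop := IsXi {
  xi_iso : forall G H, mgraph_iso G H -> xi G = xi H;
  xi_rec : forall (G : mgraph) (e : edge G),
    xi G = xi (del_edge e) + Zy * xi (contract_edge e)
           + Zz * xi (extract_edge e);
  xi_disj : forall G H, xi (disj_union G H) = xi G * xi H;
  xi_E1 : xi E1 = Zx;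
  xi_empty : xi empty_mgraph = 1
}.

Definition covered (G : mgraph) (S : {set edge G}) : {set vert G} :=
  \bigcup_(f in S) ends f.

Definition adj (G : mgraph) (S : {set edge G}) : rel (vert G) :=
  fun u v => [exists f in S, (u \in ends f) && (v \in ends f)].

(* Number of connected components of the graph (W, S); meaningful when W
   contains [covered S], so that W is closed under adjacency. *)
Definition ncomp (G : mgraph) (W : {set vert G}) (S : {set edge G}) : nat :=
  n_comp (adj S) W.

Definition k (G : mgraph) (S : {set edge G}) : nat := ncomp [set: vert G] S.
Definition kcov (G : mgraph) (S : {set edge G}) : nat := ncomp (covered S) S.

(* When [covered A] and [covered B] are disjoint, each component of the graph
   (covered B, B) is a component of (V, A :|: B) and contains an edge of B, so
   the natural-number differences [k (A :|: B) - kcov B] and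
   [#|A| + #|B| - kcov B] are never truncated. *)

(* Main.v *)
Require Import Defs.
From HB Require Import structures.
From mathcomp Require Import all_boot all_order all_algebra.
From mathcomp Require Import mpoly.
From mathcomp Require Import ring zify.

Set Implicit Arguments.
Unset Strict Implicit.
Unset Printing Implicit Defensive.

Import GRing.Theory.
Local Open Scope ring_scope.

(** The subset expansion itself satisfies the axioms, and the axioms determine
    their solution by induction on the number of edges, the edgeless graph on
    [n] vertices being a disjoint union of [n] copies of [E1].  For the
    recurrence at [e], split the pairs [(A, B)] in three: those avoiding [e] are
    the pairs of the deletion; those where [e] is a whole component of
    [(covered B, B)] are the pairs of [extract_edge e]; in all others,
    forgetting [e] gives a pair of the contraction, and every such pair arises
    exactly once because the contracted vertex tells which of [A], [B]
    contained [e]. *)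

(** * Adjacency, covered vertices and component counts *)

Section Components.

Implicit Types G H : mgraph.

Lemma adjP G (S : {set edge G}) u v :
  reflect (exists2 f, f \in S & (u \in ends f) && (v \in ends f)) (adj S u v).
Proof. exact: exists_inP. Qed.

Lemma adj_sym G (S : {set edge G}) : ssrbool.symmetric (adj S).
Proof.
by move=> u v; apply/adjP/adjP => -[f Sf uv]; exists f => //; rewrite andbC.
Qed.

Lemma adj_connect_sym G (S : {set edge G}) : connect_sym (adj S).
Proof. exact/sym_connect_sym/adj_sym. Qed.

Lemma coveredP G (S : {set edge G}) v :
  reflect (exists2 f, f \in S & v \in ends f) (v \in covered S).
Proof. exact: bigcupP. Qed.

Lemma coveredU G (S T : {set edge G}) :
  covered (S :|: T) = covered S :|: covered T.
Proof. by rewrite /covered bigcup_setU. Qed.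

Lemma covered1 G (e : edge G) : covered [set e] = ends e.
Proof. by rewrite /covered big_set1. Qed.

Lemma closed_adj G (S : {set edge G}) (W : {set vert G}) :
  (forall f x y, f \in S -> x \in ends f -> y \in ends f ->
     x \in W -> y \in W) ->
  closed (adj S) W.
Proof.
move=> cl; apply: (intro_closed (adj_connect_sym S)) => x y.
by case/adjP => f Sf /andP[fx fy]; apply: (cl f).
Qed.

(** An edge of [A] never reaches a vertex covered by [B], and an edge of [B] has all its ends in
    [covered B]. *)
Lemma closed_adj_covered G (A B : {set edge G}) :
  [disjoint covered A & covered B] -> closed (adj (A :|: B)) (covered B).
Proof.
move=> dAB; apply: closed_adj => f x y; rewrite inE.
case/orP=> [Af | Bf] fx fy Bx; last by apply/coveredP; exists f.
have Ax : x \in covered A by apply/coveredP; exists f.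
by rewrite (disjointFr dAB Ax) in Bx.
Qed.

Lemma closed_covered G (S : {set edge G}) : closed (adj S) (covered S).
Proof. by apply: closed_adj => f x y Sf _ fy _; apply/coveredP; exists f. Qed.

(** [n_comp] counts the component roots lying in the given set, and counting is additive over
    disjoint sets. *)
Lemma ncompU G (W1 W2 : {set vert G}) (S : {set edge G}) :
  [disjoint W1 & W2] -> ncomp (W1 :|: W2) S = (ncomp W1 S + ncomp W2 S)%N.
Proof.
move=> dW; rewrite /ncomp /n_comp_mem -cardUI [X in (_ + X)%N]eq_card0 ?addn0.
  by apply: eq_card => x; rewrite !inE andb_orr.
move=> x; rewrite !inE; apply/negP => /andP[/andP[_ W1x] /andP[_ W2x]].
by rewrite (disjointFr dW W1x) in W2x.
Qed.

(* The map [h] may identify vertices, but only ones already connected by [S]. *)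
Lemma ncomp_quotient G H (h : vert G -> vert H) (W : {set vert H})
    (S : {set edge G}) (S' : {set edge H}) :
  closed (adj S') W ->
  (forall v, v \in W -> exists x, h x = v) ->
  (forall x y, h x \in W -> h x = h y -> connect (adj S) x y) ->
  (forall x y, h x \in W -> adj S x y -> connect (adj S') (h x) (h y)) ->
  (forall u v, u \in W -> adj S' u v ->
     exists x y, [/\ h x = u, h y = v & connect (adj S) x y]) ->
  ncomp (h @^-1: W) S = ncomp W S'.
Proof.
move=> clW surj fib push lift; rewrite /ncomp.
(* A relation adjunction along [h] gives equal counts: every vertex of [W] must be hit up to
   connection, and above [W] the map must preserve and reflect connectedness. *)
rewrite (adjunction_n_comp h (adj_connect_sym S') (adj_connect_sym S) clW).
  by apply: eq_n_comp_r => x; rewrite !inE.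
split=> [u Wu | x y Whx].
  have ex : exists x, h x == u by have [x <-] := surj u Wu; exists x.
  by exists (xchoose ex); rewrite (eqP (xchooseP ex)) connect0.
apply/idP/idP => /connectP[p].
  elim: p x Whx => [|z p IHp] x Whx /= => [_ -> // | /andP[xz pz] def_y].
  have hxz := push _ _ Whx xz; apply: (connect_trans hxz).
  by apply: IHp => //; rewrite -(closed_connect clW hxz).
(* For reflection, a path in [H] is lifted edge by edge: [lift] yields ends [x1], [y1] above the
   current edge, and [fib] joins the vertex [x] reached so far to [x1]. *)
move def_u : (h x) => u; move: def_u.
elim: p x u Whx => [|z p IHp] x u Whx hxu /=.
  by move=> _ hyu; apply: (fib _ _ Whx); rewrite hxu.
case/andP=> uz pz def_y.
have [x1 [y1 [hx1 hy1 x1y1]]] : exists x1 y1,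
    [/\ h x1 = u, h y1 = z & connect (adj S) x1 y1].
  by apply: lift; rewrite // -hxu.
have hxx1 : h x = h x1 by rewrite hxu hx1.
apply: connect_trans (fib _ _ Whx hxx1) (connect_trans x1y1 _).
apply: (IHp _ _ _ hy1 pz def_y).
by rewrite hy1 -(clW _ _ uz) -hxu.
Qed.

(** The edges of [S'] that meet [W] all belong to [S], so both edge sets give the same components
    inside [W]; this is the quotient lemma for the identity map. *)
Lemma ncomp_subset_edges G (W : {set vert G}) (S S' : {set edge G}) :
  S \subset S' -> closed (adj S') W ->
  (forall f x, f \in S' -> x \in ends f -> x \in W -> f \in S) ->
  ncomp W S = ncomp W S'.
Proof.
move=> sS clW inS.
have {1}-> : W = id @^-1: W by apply/setP => x; rewrite inE.
apply: ncomp_quotient => // [v _ | x y _ -> // | x y _ | u v Wu].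
- by exists v.
- case/adjP=> f Sf xy; apply: connect1; apply/adjP; exists f => //.
  exact: (subsetP sS).
case/adjP=> f Sf /andP[fu fv]; exists u, v; split=> //; apply: connect1.
by apply/adjP; exists f; rewrite ?fu //; apply: inS Sf fu Wu.
Qed.

(** Sending each root in [covered B] to an edge of [B] at that root is injective: two roots on a
    common edge are connected, hence equal. *)
Lemma kcov_le_card G (B : {set edge G}) : (kcov B <= #|B|)%N.
Proof.
pose phi v := [pick f in B | v \in ends f].
have phiP v : v \in covered B -> exists2 f, phi v = Some f
    & (f \in B) && (v \in ends f).
  case/coveredP=> g Bg gv; rewrite /phi; case: pickP => [f fP | /(_ g)].
    by exists f.
  by rewrite Bg gv.
rewrite /kcov /ncomp /n_comp_mem.
have inj : {in [predI roots (adj B) & covered B] &, injective phi}.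
  move=> u v /andP[/eqP ru Bu] /andP[/eqP rv Bv].
  have [f -> /andP[Bf fu]] := phiP u Bu; have [g -> /andP[_ gv]] := phiP v Bv.
  case=> fg; rewrite -{}fg in gv; rewrite -ru -rv.
  apply/(fingraph.rootP (@adj_connect_sym _ _)).
  by apply/connect1/adjP; exists f; rewrite ?fu.
rewrite -(card_in_image inj) -(card_imset _ Some_inj).
apply/subset_leq_card/subsetP => o /imageP[v /andP[_ Bv] ->].
by have [f -> /andP[Bf _]] := phiP v Bv; apply: imset_f.
Qed.

(** Since [covered B] is closed under [A :|: B], the components counted by [kcov B] are those of the
    whole spanning subgraph that lie in [covered B]. *)
Lemma kcov_le_k G (A B : {set edge G}) :
  [disjoint covered A & covered B] -> (kcov B <= k (A :|: B))%N.
Proof.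
move=> dAB; rewrite /kcov (ncomp_subset_edges (subsetUr A B)); first last.
- move=> f x; rewrite inE => /orP[Af fx Bx|//].
  have Ax : x \in covered A by apply/coveredP; exists f.
  by rewrite (disjointFr dAB Ax) in Bx.
- exact: closed_adj_covered.
by apply/subset_leq_card/subsetP => x; rewrite !inE => /andP[->].
Qed.

(** The edge [e] joins its endpoints, and closedness keeps their component inside [ends e]. *)
Lemma ncomp_ends G (e : edge G) (S : {set edge G}) :
  e \in S -> closed (adj S) (ends e) -> ncomp (ends e) S = 1%N.
Proof.
move=> Se cle; have /andP[/card_gt0P[u eu] _] := ends_card e.
rewrite -(n_comp_connect (adj_connect_sym S) u); apply: eq_n_comp_r => v.
apply/idP/idP => [ev | uv]; last by rewrite -(closed_connect cle uv).
by apply/connect1/adjP; exists e; rewrite ?eu.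
Qed.

End Components.

(** * Component counts under graph embeddings *)

Section Embedding.

Variables (G H : mgraph) (h : vert G -> vert H) (phi : edge G -> edge H).
Hypothesis h_inj : injective h.
Hypothesis ends_phi : forall f, ends (phi f) = h @: ends f.

Lemma mem_ends_emb f x : (h x \in ends (phi f)) = (x \in ends f).
Proof. by rewrite ends_phi mem_imset. Qed.

(** An instance of [ncomp_quotient] with trivial fibres. Only edges of [S'] meeting [W] are asked to
    come from [phi], so that [S'] may contain an extracted edge away from [W]. *)
Lemma ncomp_emb (W : {set vert H}) (S' : {set edge H}) :
  closed (adj S') W -> W \subset codom h ->
  (forall f x, f \in S' -> x \in ends f -> x \in W -> f \in codom phi) ->
  ncomp (h @^-1: W) (phi @^-1: S') = ncomp W S'.
Proof.
move=> clW /subsetP sW inphi; apply: ncomp_quotient => //.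
- by move=> v /sW /codomP[x ->]; exists x.
- by move=> x y _ /h_inj ->.
- move=> x y _ /adjP[f]; rewrite inE => Sf fxy; apply/connect1/adjP.
  by exists (phi f); rewrite ?mem_ends_emb.
move=> u v Wu uv; have Wv : v \in W by rewrite -(clW _ _ uv).
have [x def_u] := codomP (sW u Wu); have [y def_v] := codomP (sW v Wv).
case/adjP: uv => f Sf /andP[fu fv].
have [g def_f] := codomP (inphi f u Sf fu Wu).
exists x, y; split=> //; apply/connect1/adjP; exists g;
  first by rewrite inE -def_f.
by rewrite -!mem_ends_emb -def_u -def_v -def_f fu.
Qed.

Lemma covered_emb (S' : {set edge H}) :
  (forall f x, f \in S' -> h x \in ends f -> f \in codom phi) ->
  covered (phi @^-1: S') = h @^-1: covered S'.
Proof.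
move=> inphi; apply/setP => x; rewrite inE; apply/coveredP/coveredP => -[f].
  by rewrite inE => Sf fx; exists (phi f); rewrite ?mem_ends_emb.
move=> Sf fx; have [g def_f] := codomP (inphi f x Sf fx).
by exists g; rewrite ?inE -?def_f // -mem_ends_emb -def_f.
Qed.

End Embedding.

(** * Images and preimages of finite sets *)

Section ImsetPreimset.

Variables (aT rT : finType) (f : aT -> rT).

Lemma preimset_imset (A : {set aT}) : injective f -> f @^-1: (f @: A) = A.
Proof. by move=> f_inj; apply/setP => x; rewrite inE mem_imset. Qed.

Lemma imset_preimset (B : {set rT}) : B \subset codom f -> f @: (f @^-1: B) = B.
Proof.
move/subsetP => sB; apply/setP => y; apply/imsetP/idP => [[x]|By].
  by rewrite inE => Bx ->.
by have /codomP[x def_y] := sB y By; exists x; rewrite ?inE -?def_y.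
Qed.

Lemma card_preimset_codom (B : {set rT}) :
  injective f -> B \subset codom f -> #|f @^-1: B| = #|B|.
Proof. by move=> f_inj sB; rewrite -[in RHS](imset_preimset sB) card_imset. Qed.

Lemma disjoint_imset (A : {set aT}) (B : {set rT}) :
  [disjoint f @: A & B] = [disjoint A & f @^-1: B].
Proof.
rewrite !disjoints_subset; apply/subsetP/subsetP => sAB.
  by move=> x Ax; have := sAB _ (imset_f f Ax); rewrite !inE.
by move=> _ /imsetP[x Ax ->]; have := sAB x Ax; rewrite !inE.
Qed.

Lemma disjoint_preimset (A B : {set rT}) :
  A \subset codom f -> [disjoint f @^-1: A & f @^-1: B] = [disjoint A & B].
Proof. by move=> sA; rewrite -disjoint_imset imset_preimset. Qed.

End ImsetPreimset.

Lemma subUset_pred (T : finType) (A B : {set T}) (P : {pred T}) :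
  (A :|: B \subset P) = (A \subset P) && (B \subset P).
Proof.
apply/subsetP/andP => [sP | [/subsetP sA /subsetP sB] a].
  by split; apply/subsetP => a sa; apply: sP; rewrite inE sa ?orbT.
by rewrite inE => /orP[/sA|/sB].
Qed.

Lemma setD1_notin (T : finType) (A : {set T}) a : a \notin A -> A :\ a = A.
Proof. by move=> nAa; apply/setDidPl; rewrite disjoint_sym disjoints1. Qed.

(** * Reindexing of finite sums *)

Section ReindexPull.

Variables (R : nmodType) (I J : finType) (push : J -> I) (pull : I -> J).

(** [push] and [pull] restrict to inverse bijections between [Q] and [P]. Summands are compared
    through [pull], which in the applications takes preimages of edge sets, the form in which the
    counting lemmas are stated. *)
Lemma sum_pull (P : pred I) (Q : pred J) (F : I -> R) (F' : J -> R) :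
  cancel push pull ->
  (forall i, P i -> push (pull i) = i) ->
  (forall j, Q j -> P (push j)) ->
  (forall i, P i -> Q (pull i)) ->
  (forall i, P i -> F i = F' (pull i)) ->
  \sum_(i | P i) F i = \sum_(j | Q j) F' j.
Proof.
move=> pushK pullK QP PQ FF'; rewrite (reindex_onto push pull) //.
apply: eq_big => [j | j /andP[Pj _]]; last by rewrite FF' // pushK.
rewrite pushK eqxx andbT; apply/idP/idP => [/PQ|/QP //].
by rewrite pushK.
Qed.

End ReindexPull.

(** * Embeddings that are bijective on vertices *)

Section SurjectiveEmbedding.

Variables (G H : mgraph) (h : vert G -> vert H) (phi : edge G -> edge H).
Hypothesis h_inj : injective h.
Hypothesis h_surj : forall v, v \in codom h.
Hypothesis ends_phi : forall f, ends (phi f) = h @: ends f.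
Variable S : {set edge H}.
Hypothesis sS : S \subset codom phi.

Lemma k_emb : k (phi @^-1: S) = k S.
Proof.
rewrite /k -(ncomp_emb h_inj ends_phi) ?preimsetT //; first by move=> u v;
  rewrite !inE.
  exact/subsetP.
by move=> f v Sf _ _; apply: (subsetP sS).
Qed.

Lemma covered_surj_emb : covered (phi @^-1: S) = h @^-1: covered S.
Proof. by apply: covered_emb => // f v Sf _; apply: (subsetP sS). Qed.

Lemma kcov_emb : kcov (phi @^-1: S) = kcov S.
Proof.
rewrite /kcov covered_surj_emb (ncomp_emb h_inj ends_phi) //.
- exact: closed_covered.
- exact/subsetP.
by move=> f v Sf _ _; apply: (subsetP sS).
Qed.

End SurjectiveEmbedding.

(** * Extraction of an edge *)

Section ExtractEdge.

Variables (G : mgraph) (e : edge G).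

Definition extract_vval (v : vert (extract_edge e)) : vert G := val v.
Definition extract_eval (f : edge (extract_edge e)) : edge G := val f.

Lemma extract_vval_inj : injective extract_vval. Proof. exact: val_inj. Qed.
Lemma extract_eval_inj : injective extract_eval. Proof. exact: val_inj. Qed.

Lemma extract_vvalP v : extract_vval v \notin ends e.
Proof. by have := valP v; rewrite inE. Qed.

Lemma extract_evalP f : ends (extract_eval f) \subset ~: ends e.
Proof. exact: valP f. Qed.

Lemma ends_extract_eval f : ends (extract_eval f) = extract_vval @: ends f.
Proof.
apply/setP => v; apply/idP/imsetP => [fv | [w]]; last by rewrite inE => fw ->.
by exists (exist _ v (subsetP (extract_evalP f) v fv)); rewrite ?inE.
Qed.

Variable S : {set edge G}.
Hypothesis dS : [disjoint ends e & covered (S :\ e)].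

Lemma ends_disjoint_extract f : f \in S -> f != e -> ends f \subset ~: ends e.
Proof.
move=> Sf nfe; apply/subsetP => v fv; rewrite inE.
have Sv : v \in covered (S :\ e) by apply/coveredP; exists f; rewrite ?inE ?nfe.
by rewrite (disjointFl dS Sv).
Qed.

Lemma mem_codom_extract f : f \in S -> f != e ->
  f \in codom extract_eval.
Proof.
move=> Sf nfe; apply/codomP.
by exists (exist _ f (ends_disjoint_extract Sf nfe)).
Qed.

Lemma mem_codom_extract_ends f v :
  f \in S -> v \in ends f -> v \notin ends e ->
  f \in codom extract_eval.
Proof.
move=> Sf fv nev; apply: mem_codom_extract => //.
by apply: contraNneq nev => <-.
Qed.

Lemma closed_ends : closed (adj S) (ends e).
Proof.
apply: closed_adj => f u v Sf fu fv eu; have [<- // | nfe] := eqVneq f e.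
by have := subsetP (ends_disjoint_extract Sf nfe) u fu; rewrite inE eu.
Qed.

Lemma covered_extract :
  covered (extract_eval @^-1: S) = extract_vval @^-1: covered S.
Proof.
apply: (covered_emb extract_vval_inj ends_extract_eval) => f v Sf fv.
by apply: mem_codom_extract_ends Sf fv (extract_vvalP v).
Qed.

Lemma ncomp_extract (W : {set vert G}) :
  closed (adj S) W -> [disjoint ends e & W] ->
  ncomp (extract_vval @^-1: W) (extract_eval @^-1: S) = ncomp W S.
Proof.
move=> clW dW; apply: (ncomp_emb extract_vval_inj ends_extract_eval) => //.
  apply/subsetP => v Wv; apply/codomP.
  have nev : v \in ~: ends e by rewrite inE (disjointFl dW Wv).
  by exists (exist _ v nev).
move=> f v Sf fv Wv; apply: mem_codom_extract_ends Sf fv _.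
by rewrite (disjointFl dW Wv).
Qed.

Hypothesis Se : e \in S.

(** The endpoints of [e] form one component by themselves; the vertices outside it, with the other
    edges of [S], live in [extract_edge e]. The same split of [covered S] gives the count for
    [kcov]. *)
Lemma k_extract : k S = (k (extract_eval @^-1: S)).+1.
Proof.
rewrite /k -(setUCr (ends e)) ncompU -?setI_eq0 ?setICr //.
rewrite (ncomp_ends Se closed_ends) -ncomp_extract -?setI_eq0 ?setICr //.
  by rewrite add1n; congr (ncomp _ _).+1; apply/setP => v;
    have := extract_vvalP v; rewrite !inE.
move=> u v uv; have := closed_ends uv.
by rewrite !inE => ->.
Qed.

Lemma kcov_extract :
  kcov S = (kcov (extract_eval @^-1: S)).+1.
Proof.
have cS : covered S = ends e :|: covered (S :\ e).
  by rewrite -{1}(setD1K Se) coveredU covered1.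
rewrite /kcov cS ncompU // (ncomp_ends Se closed_ends) -ncomp_extract //.
  rewrite add1n covered_extract cS; congr (ncomp _ _).+1.
  by apply/setP => v; have := extract_vvalP v; rewrite !inE => /negPf ->.
rewrite -[S in adj S](setD1K Se); apply: closed_adj_covered.
by rewrite covered1.
Qed.

End ExtractEdge.

Arguments extract_vval {G e} v.
Arguments extract_eval {G e} f.

(** * Contraction of an edge *)

Section Contraction.

Variables (G : mgraph) (e : edge G).

Definition contract_map (v : vert G) : vert (contract_edge e) :=
  (insub v : contract_vert e).

Definition contract_eval (f : edge (contract_edge e)) : edge G := val f.

Lemma contract_eval_inj : injective contract_eval. Proof. exact: val_inj. Qed.

Lemma contract_evalP f : contract_eval f != e.
Proof. exact: valP f. Qed.

Lemma contract_map_eq_None v : (contract_map v == None) = (v \in ends e).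
Proof. by rewrite /contract_map; case: insubP => [w /negPf -> | /negPn]. Qed.

Lemma contract_map_inj u v : u \notin ends e ->
  contract_map u = contract_map v -> u = v.
Proof.
rewrite /contract_map => neu.
case: insubP => [w _ <- | ]; last by rewrite neu.
by case: insubP => // w' _ <- [->].
Qed.

Lemma contract_map_surj v' : exists v, contract_map v = v'.
Proof.
case: v' => [w|]; first by exists (val w); rewrite /contract_map valK.
have /andP[/card_gt0P[u eu] _] := ends_card e.
by exists u; apply/eqP; rewrite contract_map_eq_None.
Qed.

Lemma covered_contract (S : {set edge G}) :
  covered (contract_eval @^-1: S) =
  contract_map @: covered (S :\ e).
Proof.
apply/setP => v'; apply/coveredP/imsetP => [[f] | [v /coveredP[f]]].
  rewrite inE => Sf /imsetP[v fv ->]; exists v => //.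
  by apply/coveredP; exists (contract_eval f); rewrite ?inE ?contract_evalP.
rewrite !inE => /andP[nfe Sf] fv ->.
by exists (exist _ f nfe); rewrite ?inE //; apply/imsetP; exists v.
Qed.

(** An edge of the contraction reaches [None] exactly through an endpoint of [e]. This is the test
    by which [e] is later returned to one of the two classes. *)
Lemma None_covered_contract (S : {set edge G}) :
  (None \in covered (contract_eval @^-1: S)) =
  ~~ [disjoint ends e & covered (S :\ e)].
Proof.
rewrite covered_contract -setI_eq0; apply/imsetP/set0Pn => [[v Sv] | [v]].
  by move/esym/eqP; rewrite contract_map_eq_None => ev; exists v;
    rewrite inE ev.
rewrite inE => /andP[ev Sv]; exists v => //.
by apply/esym/eqP; rewrite contract_map_eq_None.
Qed.

(** The only vertices identified are the endpoints of [e], which form the fibre above [None]. When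
    [W] contains [None], membership of [e] in [S] keeps that fibre connected. *)
Lemma ncomp_contract (S : {set edge G}) (W : {set vert (contract_edge e)}) :
  closed (adj (contract_eval @^-1: S)) W ->
  (None \in W -> e \in S) ->
  ncomp (contract_map @^-1: W) S =
  ncomp W (contract_eval @^-1: S).
Proof.
move=> clW WS; apply: ncomp_quotient => //.
- by move=> v _; apply: contract_map_surj.
- move=> u v Wu uv; have [eu | neu] := boolP (u \in ends e); last first.
    by rewrite (contract_map_inj neu uv).
  have qu : contract_map u = None by apply/eqP; rewrite contract_map_eq_None.
  have ev : v \in ends e by rewrite -contract_map_eq_None -uv qu.
  apply/connect1/adjP; exists e; rewrite ?eu //.
  by apply: WS; rewrite -qu.
- move=> u v _ /adjP[f Sf /andP[fu fv]]; have [def_f | nfe] := eqVneq f e.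
    rewrite def_f -!contract_map_eq_None in fu fv.
    by rewrite (eqP fu) (eqP fv).
  apply/connect1/adjP; exists (exist _ f nfe); rewrite ?inE //.
  by apply/andP; split; apply/imsetP; [exists u | exists v].
move=> u' v' _ /adjP[f]; rewrite inE => Sf /andP[].
move=> /imsetP[u fu ->] /imsetP[v fv ->]; exists u, v; split=> //.
by apply/connect1/adjP; exists (contract_eval f); rewrite ?fu.
Qed.

Lemma k_contract (S : {set edge G}) : e \in S ->
  k (contract_eval @^-1: S) = k S.
Proof.
by move=> Se; rewrite /k -ncomp_contract ?preimsetT // => u v; rewrite !inE.
Qed.

(** The hypothesis treats two cases at once: either [e] is in [B] and meets another edge of [B], or
    [e] is outside [B] and no edge of [B] meets it. In the first case the endpoints of [e] and the
    contracted vertex are all covered, in the second none of them is. *)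
Lemma preimset_covered_contract (B : {set edge G}) :
  (e \in B) = ~~ [disjoint ends e & covered (B :\ e)] ->
  contract_map @^-1: covered (contract_eval @^-1: B) =
  covered B.
Proof.
rewrite -None_covered_contract => eB; apply/setP => v; rewrite inE.
have [ev | nev] := boolP (v \in ends e).
  have /eqP -> : contract_map v == None by rewrite contract_map_eq_None.
  rewrite -eB; apply/idP/idP => [Be | Bv]; first by apply/coveredP; exists e.
  have [// | nBe] := boolP (e \in B).
  have := nBe; rewrite eB None_covered_contract negbK => dB.
  have := disjointFr dB ev.
  by rewrite (setD1_notin nBe) Bv.
rewrite covered_contract;
  apply/imsetP/idP => [[w Bw /(contract_map_inj nev) ->] | Bv].
  by case/coveredP: Bw => f; rewrite inE => /andP[_ Bf] fw; apply/coveredP;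
    exists f.
exists v => //; case/coveredP: Bv => f Bf fv; apply/coveredP; exists f => //.
by rewrite !inE Bf andbT; apply: contraNneq nev => <-.
Qed.

Lemma kcov_contract (B : {set edge G}) :
  (e \in B) = ~~ [disjoint ends e & covered (B :\ e)] ->
  kcov (contract_eval @^-1: B) = kcov B.
Proof.
move=> eB; rewrite /kcov -ncomp_contract ?preimset_covered_contract //.
  exact: closed_covered.
by rewrite None_covered_contract -eB.
Qed.

End Contraction.

Arguments contract_map {G e} v.
Arguments contract_eval {G e} f.

(** * Disjoint unions *)

Section DisjointUnion.

Variables G H : mgraph.
Let U := disj_union G H.

Definition disj_vinl (v : vert G) : vert U := inl v.
Definition disj_vinr (v : vert H) : vert U := inr v.
Definition disj_einl (f : edge G) : edge U := inl f.
Definition disj_einr (f : edge H) : edge U := inr f.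

Lemma disj_vinl_inj : injective disj_vinl. Proof. by move=> u v []. Qed.
Lemma disj_vinr_inj : injective disj_vinr. Proof. by move=> u v []. Qed.
Lemma disj_einl_inj : injective disj_einl. Proof. by move=> u v []. Qed.
Lemma disj_einr_inj : injective disj_einr. Proof. by move=> u v []. Qed.

Lemma ends_disj_einl f : ends (disj_einl f) = disj_vinl @: ends f.
Proof. by []. Qed.

Lemma ends_disj_einr f : ends (disj_einr f) = disj_vinr @: ends f.
Proof. by []. Qed.

Lemma codom_disj_einl f v : disj_vinl v \in ends f -> f \in codom disj_einl.
Proof.
case: f => f; last by case/imsetP.
by move=> _; apply/codomP; exists f.
Qed.

Lemma codom_disj_einr f v : disj_vinr v \in ends f -> f \in codom disj_einr.
Proof.
case: f => f; first by case/imsetP.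
by move=> _; apply/codomP; exists f.
Qed.

Variable S : {set edge U}.

Lemma covered_disj_inl :
  covered (disj_einl @^-1: S) = disj_vinl @^-1: covered S.
Proof.
apply: (covered_emb disj_vinl_inj ends_disj_einl) => f v _.
exact: codom_disj_einl.
Qed.

Lemma covered_disj_inr :
  covered (disj_einr @^-1: S) = disj_vinr @^-1: covered S.
Proof.
apply: (covered_emb disj_vinr_inj ends_disj_einr) => f v _.
exact: codom_disj_einr.
Qed.

Lemma ncomp_disj (W : {set vert U}) : closed (adj S) W ->
  ncomp W S = (ncomp (disj_vinl @^-1: W) (disj_einl @^-1: S)
               + ncomp (disj_vinr @^-1: W) (disj_einr @^-1: S))%N.
Proof.
(* [L] consists of the vertices coming from [G]. No edge crosses it, so [W] splits into two closed
   pieces, each inside the image of one embedding. *)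
move=> clW; pose L := [set v : vert U | if v is inl _ then true else false].
have clL : closed (adj S) L.
  apply: closed_adj => -[f|f] u v _ /imsetP[u' _ ->] /imsetP[v' _ ->];
  by rewrite !inE.
rewrite -{1}(setID W L) ncompU; last first.
  by rewrite disjoints_subset setDE setCI setCK (subset_trans (subsetIr _ _))
    ?subsetUr.
congr addn.
  have -> : disj_vinl @^-1: W = disj_vinl @^-1: (W :&: L).
    by apply/setP => v; rewrite !inE andbT.
  rewrite (ncomp_emb disj_vinl_inj ends_disj_einl) //.
  - by move=> u v uv; rewrite !in_setI (clW _ _ uv) (clL _ _ uv).
  - by apply/subsetP => -[v|v]; rewrite !inE ?andbF // => _; apply/codomP;
    exists v.
  by move=> f [v|v] _ fv; rewrite !inE ?andbF // => _;
    apply: codom_disj_einl fv.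
have -> : disj_vinr @^-1: W = disj_vinr @^-1: (W :\: L).
  by apply/setP => v; rewrite !inE.
rewrite (ncomp_emb disj_vinr_inj ends_disj_einr) //.
- by move=> u v uv; rewrite !in_setD (clW _ _ uv) (clL _ _ uv).
- by apply/subsetP => -[v|v]; rewrite !inE // => _; apply/codomP; exists v.
by move=> f [v|v] _ fv; rewrite !inE // => _; apply: codom_disj_einr fv.
Qed.

Lemma k_disj : k S = (k (disj_einl @^-1: S) + k (disj_einr @^-1: S))%N.
Proof. by rewrite /k ncomp_disj ?preimsetT // => u v; rewrite !inE. Qed.

Lemma kcov_disj :
  kcov S = (kcov (disj_einl @^-1: S) + kcov (disj_einr @^-1: S))%N.
Proof.
rewrite /kcov ncomp_disj ?covered_disj_inl ?covered_disj_inr //.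
exact: closed_covered.
Qed.

Lemma disj_setE :
  S = disj_einl @: (disj_einl @^-1: S) :|: disj_einr @: (disj_einr @^-1: S).
Proof.
apply/setP => f; rewrite inE; apply/idP/orP => [Sf | []].
- by case: f Sf => f Sf; [left | right]; apply/imsetP; exists f; rewrite ?inE.
- by case/imsetP=> g; rewrite inE => Sg ->.
by case/imsetP=> g; rewrite inE => Sg ->.
Qed.

Lemma card_disj : #|S| = (#|disj_einl @^-1: S| + #|disj_einr @^-1: S|)%N.
Proof.
rewrite {1}disj_setE cardsU [_ :&: _](_ : _ = set0); last first.
  by apply/setP => -[f|f]; rewrite !inE;
    apply/negP => /andP[/imsetP[? ? ?] /imsetP[? ? ?]].
rewrite cards0 subn0 !card_imset //; first exact: disj_einr_inj.
exact: disj_einl_inj.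
Qed.

End DisjointUnion.

Arguments disj_einl {G} H f.
Arguments disj_einr G {H} f.

Lemma preimset_disj_inl (G H : mgraph) (S : {set edge G}) (T : {set edge H}) :
  disj_einl H @^-1: (disj_einl H @: S :|: disj_einr G @: T) = S.
Proof.
apply/setP => f; rewrite !inE mem_imset; last exact: disj_einl_inj.
by apply/orb_idr => /imsetP[].
Qed.

Lemma preimset_disj_inr (G H : mgraph) (S : {set edge G}) (T : {set edge H}) :
  disj_einr G @^-1: (disj_einl H @: S :|: disj_einr G @: T) = T.
Proof.
apply/setP => f; rewrite !inE orbC mem_imset; last exact: disj_einr_inj.
by apply/orb_idr => /imsetP[].
Qed.

(** * The subset expansion over a commutative ring, and its isomorphism invariance *)

Section Expansion.

Variables (R : comNzRingType) (x y z : R).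

Definition weight (G : mgraph) (AB : {set edge G} * {set edge G}) : R :=
  x ^+ (k (AB.1 :|: AB.2) - kcov AB.2)
  * y ^+ (#|AB.1| + #|AB.2| - kcov AB.2) * z ^+ kcov AB.2.

Definition admissible (G : mgraph) (AB : {set edge G} * {set edge G}) :=
  [disjoint covered AB.1 & covered AB.2].

Definition expansion (G : mgraph) : R :=
  \sum_(AB : {set edge G} * {set edge G} | admissible AB) weight AB.

Definition preimset_pair (G H : mgraph) (phi : edge G -> edge H)
  (AB : {set edge H} * {set edge H}) := (phi @^-1: AB.1, phi @^-1: AB.2).

Definition imset_pair (G H : mgraph) (phi : edge G -> edge H)
  (AB : {set edge G} * {set edge G}) := (phi @: AB.1, phi @: AB.2).

Lemma preimset_pairK (G H : mgraph) (phi : edge G -> edge H) :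
  injective phi -> cancel (imset_pair phi) (preimset_pair phi).
Proof. by move=> pi [A B]; rewrite /preimset_pair /= !preimset_imset. Qed.

(** Every edge has an endpoint, so an edge in both classes would give a vertex covered by both. *)
Lemma edge_covered (G : mgraph) (A B : {set edge G}) e :
  [disjoint covered A & covered B] -> e \in A ->
  (e \notin B) && [disjoint ends e & covered B].
Proof.
move=> dAB Ae; have sA : ends e \subset covered A.
  by apply/subsetP => v ev; apply/coveredP; exists e.
have dB := disjointWl sA dAB; rewrite dB andbT; apply/negP => Be.
have /andP[/card_gt0P[u eu] _] := ends_card e.
by have := disjointFr dB eu; rewrite (introT (coveredP _ _)) //; exists e.
Qed.

Section SurjEmb.

Variables (G H : mgraph) (h : vert G -> vert H) (phi : edge G -> edge H).
Hypothesis h_inj : injective h.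
Hypothesis h_surj : forall v, v \in codom h.
Hypothesis phi_inj : injective phi.
Hypothesis ends_phi : forall f, ends (phi f) = h @: ends f.

(** Serves both isomorphisms, where [phi] reaches every edge, and deletion, where it reaches every
    edge but [e]. Vertices correspond bijectively, so coverings and component counts transfer by
    preimage. *)
Lemma expansion_surj_emb :
  \sum_(AB : {set edge H} * {set edge H}
        | admissible AB && (AB.1 :|: AB.2 \subset codom phi)) weight AB =
  expansion G.
Proof.
have admE AB : AB.1 :|: AB.2 \subset codom phi ->
    admissible (preimset_pair phi AB) = admissible AB.
  rewrite subUset_pred => /andP[sA sB]; rewrite /admissible /preimset_pair /=.
  rewrite !(covered_surj_emb h_inj ends_phi) // disjoint_preimset //.
  exact/subsetP.
apply: (sum_pull (preimset_pairK phi_inj)) => [[A B]|[A B]|AB|[A B]].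
- rewrite /= subUset_pred => /and3P[_ sA sB].
  by rewrite /imset_pair /= !imset_preimset.
- move=> adm; have sP : phi @: A :|: phi @: B \subset codom phi.
    by rewrite -imsetU; apply/subsetP => _ /imsetP[f _ ->]; apply: codom_f.
  by rewrite sP andbT -admE // preimset_pairK.
- by case/andP=> adm sAB; rewrite admE.
rewrite /weight /= => /andP[_ sAB]; have:= sAB;
  rewrite subUset_pred => /andP[sA sB].
rewrite -preimsetU (k_emb h_inj h_surj ends_phi sAB).
rewrite (kcov_emb h_inj h_surj ends_phi sB).
by rewrite (card_preimset_codom phi_inj sA) (card_preimset_codom phi_inj sB).
Qed.

End SurjEmb.

Lemma expansion_iso G H : mgraph_iso G H -> expansion G = expansion H.
Proof.
case=> h [phi [[h' hK h'K] [phi' phiK phi'K] ends_phi]].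
rewrite -(expansion_surj_emb (can_inj hK) _ (can_inj phiK) ends_phi).
  apply: eq_bigl => AB; rewrite [X in _ && X](introT subsetP) ?andbT // => f _.
  by apply/codomP; exists (phi' f).
by move=> v; apply/codomP; exists (h' v).
Qed.

(** * The deletion, contraction and extraction recurrence *)

Section Recurrence.

Variables (G : mgraph) (e : edge G).

Lemma expansion_del :
  \sum_(AB : {set edge G} * {set edge G}
        | admissible AB && (e \notin AB.1 :|: AB.2)) weight AB =
  expansion (del_edge e).
Proof.
pose phi (f : edge (del_edge e)) : edge G := val f.
rewrite -(@expansion_surj_emb (del_edge e) G id phi) //.
- apply: eq_bigl => AB; congr (_ && _); apply/idP/subsetP => [ne f fAB | sAB].
    have nfe : f != e by apply: contraNneq ne => <-.
    by apply/codomP; exists (exist _ f nfe).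
  by apply/negP => /sAB /codomP[f def_e]; have := valP f;
    rewrite -[val f]def_e eqxx.
- by move=> v; apply/codomP; exists v.
- exact: val_inj.
by move=> f; rewrite imset_id.
Qed.

(** Says that [e] alone makes up a component of [(covered B, B)]; an edge of [B] parallel to [e]
    already prevents this. *)
Definition isolated_in (B : {set edge G}) :=
  (e \in B) && [disjoint ends e & covered (B :\ e)].

Lemma codom_contract_eval f : (f \in codom (@contract_eval G e)) = (f != e).
Proof.
apply/codomP/idP => [[g ->] | nfe]; first exact: contract_evalP.
by exists (exist _ f nfe).
Qed.

Lemma imset_preimset_contract (S : {set edge G}) :
  contract_eval @: (@contract_eval G e @^-1: S) = S :\ e.
Proof.
have <- : @contract_eval G e @^-1: (S :\ e) = contract_eval @^-1: S.
  by apply/setP => f; rewrite !inE contract_evalP.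
apply: imset_preimset; apply/subsetP => f.
by rewrite codom_contract_eval !inE => /andP[].
Qed.

Lemma preimset_contractU1 (S : {set edge (contract_edge e)}) :
  @contract_eval G e @^-1: (e |: contract_eval @: S) = S.
Proof.
rewrite preimsetU preimset_imset; last exact: contract_eval_inj.
by apply/setUidPr/subsetP => f; rewrite !inE (negPf (contract_evalP f)).
Qed.

Lemma notin_imset_contract (S : {set edge (contract_edge e)}) :
  e \notin contract_eval @: S.
Proof. by apply/imsetP => -[f _ /esym/eqP];
  rewrite (negPf (contract_evalP f)). Qed.

(* The edge [e] joins whichever of the two classes already covers the
   contracted vertex, and the first class if neither does. *)
Definition contract_push
    (AB : {set edge (contract_edge e)} * {set edge (contract_edge e)}) :
    {set edge G} * {set edge G} :=
  if None \in covered AB.2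
  then (contract_eval @: AB.1, e |: contract_eval @: AB.2)
  else (e |: contract_eval @: AB.1, contract_eval @: AB.2).

Lemma contract_pushK : cancel contract_push (preimset_pair (@contract_eval G
  e)).
Proof.
case=> A B; rewrite /contract_push /preimset_pair /=.
by case: ifP => _ /=; rewrite preimset_contractU1 preimset_imset //;
  apply: contract_eval_inj.
Qed.

Definition contract_adm (AB : {set edge G} * {set edge G}) :=
  [&& admissible AB, e \in AB.1 :|: AB.2 & ~~ isolated_in AB.2].

(** Puts the third class in a form suited to reindexing: the conditions on [e] determine its place
    from the pair in the contraction, and what remains is admissibility there. *)
Lemma contract_admE AB : contract_adm AB =
  [&& e \in AB.1 :|: AB.2,
      (e \in AB.2) == ~~ [disjoint ends e & covered (AB.2 :\ e)],
      (e \in AB.1) == ~~ (e \in AB.2)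
    & admissible (preimset_pair (@contract_eval G e) AB)].
Proof.
case: AB => A B; rewrite /contract_adm /isolated_in inE /=.
(* When [T] satisfies this condition, [covered T] is pulled back from the contraction, so
   disjointness there can be tested in [G] after dropping [e] from [S]. *)
have coverD (S T : {set edge G}) :
    (e \in T) = ~~ [disjoint ends e & covered (T :\ e)] ->
    [disjoint covered (contract_eval (e := e) @^-1: S)
            & covered (contract_eval (e := e) @^-1: T)] =
    [disjoint covered (S :\ e) & covered T].
  move=> eT; rewrite covered_contract disjoint_imset.
  by rewrite preimset_covered_contract.
rewrite /admissible /preimset_pair /=.
have [Ae | nAe] := boolP (e \in A).
  rewrite /=; have [Be | nBe] /= := boolP (e \in B).
    rewrite !andbF; apply/negP => /andP[/edge_covered/(_ Ae)].
    by rewrite Be.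
  (* Here [e] lies in [A] only: admissibility means that [B] avoids the endpoints of [e] and that
     [A] without [e] is still compatible with [B]. *)
  rewrite andbT eq_sym eqbF_neg negbK.
  apply/idP/andP => [dAB | [dB]].
    have /andP[_ dB] := edge_covered dAB Ae.
    have dB' : [disjoint ends e & covered (B :\ e)] by rewrite setD1_notin.
    split=> //; rewrite coverD ?dB' ?(negPf nBe) //.
    apply: disjointWl dAB; rewrite -{2}(setD1K Ae) coveredU.
    exact: subsetUr.
  rewrite coverD ?dB ?(negPf nBe) // => dAB.
  rewrite -(setD1K Ae) coveredU covered1 -setI_eq0 setIUl setU_eq0 !setI_eq0
    dAB.
  by rewrite -{1}(setD1_notin nBe) dB.
rewrite /=; have [Be | nBe] /= := boolP (e \in B); last by rewrite andbF.
(* Here [e] lies in [B] only: not being isolated means that another edge of [B] meets [e], which is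
   what [coverD] requires. *)
rewrite eq_sym eqb_id andbC; apply: andb_id2l => dB.
by rewrite coverD ?dB // setD1_notin.
Qed.

(** Forgetting [e] preserves both component counts and lowers the number of edges by one, whence the
    factor [y]. *)
Lemma expansion_contract :
  \sum_(AB : {set edge G} * {set edge G} | contract_adm AB) weight AB =
  y * expansion (contract_edge e).
Proof.
rewrite /expansion mulr_sumr.
apply: (sum_pull contract_pushK) => [[A B]|AB|AB|[A B]].
- rewrite contract_admE /contract_push /preimset_pair /=.
  (* The test in [contract_push] becomes [e \in B], so [e] returns to the class it came from. *)
  rewrite None_covered_contract !imset_preimset_contract => /and4P[_ /eqP <- eA
    _].
  move: eA; have [Be | nBe] := boolP (e \in B).
    by rewrite eqbF_neg => nAe; rewrite setD1K // setD1_notin.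
  by rewrite eqb_id => Ae; rewrite setD1K // setD1_notin.
- move=> adm; rewrite contract_admE contract_pushK adm andbT.
  have:= None_covered_contract e (contract_push AB).2.
  have/(congr1 snd) /= -> := contract_pushK AB.
  rewrite /contract_push; case: ifP => _ /= <-; rewrite !inE eqxx /=;
  by rewrite ?orbT ?(negPf (notin_imset_contract _)).
- by rewrite contract_admE => /and4P[].
rewrite contract_admE /weight /= => /and4P[eAB /eqP eB /eqP eA _].
rewrite -preimsetU k_contract // kcov_contract //.
have cardS (S : {set edge G}) :
    #|S| = ((e \in S) + #|@contract_eval G e @^-1: S|)%N.
  by rewrite (cardsD1 e) -imset_preimset_contract card_imset //;
    exact: contract_eval_inj.
rewrite (cardS A) (cardS B) eA -(kcov_contract eB).
set a := #|_|; set b := #|_|; set c := kcov _.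
(* Exactly one class contains [e], so the edge count drops by one; [c <= b] makes the truncated
   difference drop by one too. *)
have cb : (c <= b)%N by apply: kcov_le_card.
have -> : (~~ (e \in B) + a + ((e \in B) + b) - c = (a + b - c).+1)%N.
  by case: (e \in B) => /=; lia.
rewrite exprS; ring.
Qed.

Lemma codom_extract_eval f :
  (f \in codom (@extract_eval G e)) = [disjoint ends e & ends f].
Proof.
rewrite disjoint_sym disjoints_subset.
apply/codomP/idP => [[g ->] | nfe]; first exact: extract_evalP.
by exists (exist _ f nfe).
Qed.

(** Removing the isolated [e] lowers [k], [kcov] and the number of edges by one each. The exponents
    of [x] and [y] are differences and stay the same; that of [z] drops by one. *)
Lemma expansion_extract :
  \sum_(AB : {set edge G} * {set edge G}
        | admissible AB && isolated_in AB.2) weight AB =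
  z * expansion (extract_edge e).
Proof.
have phi_inj := @extract_eval_inj G e.
have phi_e : e \notin codom (@extract_eval G e).
  rewrite codom_extract_eval -setI_eq0 setIid -card_gt0.
  by case/andP: (ends_card e).
have phiS (S : {set edge G}) : [disjoint ends e & covered S] ->
    S \subset codom (@extract_eval G e).
  move=> dS; apply/subsetP => f Sf; rewrite codom_extract_eval.
  apply: disjointWr dS; apply/subsetP => v fv; apply/coveredP; by exists f.
(* Preimages under [extract_eval] do not see [e], which is outside its image. *)
have pre1 (S : {set edge G}) :
    extract_eval (e := e) @^-1: (S :\ e) = extract_eval @^-1: S.
  apply/setP => f; rewrite !inE; apply/andb_idl => _.
  by apply: contraNneq phi_e => def_e; apply/codomP; exists f.
(* An isolated [e] belongs to the second class, so it is always returned there. *)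
pose push (AB : {set edge (extract_edge e)} * {set edge (extract_edge e)}) :=
  (extract_eval @: AB.1, e |: extract_eval @: AB.2).
have imD (S : {set edge (extract_edge e)}) :
    [disjoint ends e & covered (extract_eval @: S)].
  rewrite disjoint_sym disjoints_subset; apply/subsetP => v /coveredP[f].
  by case/imsetP=> g _ -> /(subsetP (extract_evalP g)).
have ne (S : {set edge (extract_edge e)}) : e \notin extract_eval @: S.
  by apply: contraNN phi_e => /imsetP[f _ def_e]; apply/codomP; exists f.
have pushK : cancel push (preimset_pair (@extract_eval G e)).
  case=> A B; rewrite /preimset_pair /= -(pre1 (e |: _)) setU1K //.
  by rewrite !preimset_imset.
have admD A B : admissible (A, B) && isolated_in B ->
    [/\ e \in B, e \notin A, [disjoint ends e & covered (B :\ e)]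
      & [disjoint ends e & covered A]].
  rewrite /admissible /isolated_in /= disjoint_sym => /and3P[dAB Be dB].
  by have /andP[] := edge_covered dAB Be.
have covS (S : {set edge G}) : [disjoint ends e & covered (S :\ e)] ->
    covered (extract_eval @^-1: S) = extract_vval (e := e) @^-1: covered (S :\
      e).
  move=> dS; rewrite -pre1 covered_extract //.
  by rewrite [_ :\ e :\ e]setD1_notin ?setD11.
have vcodom (S : {set edge G}) : [disjoint ends e & covered S] ->
    covered S \subset codom (@extract_vval G e).
  move=> dS; apply/subsetP => v Sv; apply/codomP.
  have nev : v \in ~: ends e by rewrite inE (disjointFl dS Sv).
  by exists (exist _ v nev).
rewrite /expansion mulr_sumr.
apply: (sum_pull pushK) => [[A B]|[A B] adm|[A B]|[A B]].
- case/admD => Be nAe dB dA; rewrite /push /preimset_pair /=.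
  by rewrite -(pre1 B) !imset_preimset ?phiS // setD1K.
- rewrite /isolated_in /push /= !inE eqxx setU1K // imD andbT /=.
  rewrite /admissible /= coveredU covered1 disjoint_sym.
  rewrite -setI_eq0 setIUl setU_eq0 !setI_eq0 imD /= disjoint_sym.
  rewrite -(disjoint_preimset _ (vcodom _ (imD A))).
  move: adm; rewrite /admissible /=.
  rewrite -{1}(preimset_imset A phi_inj) -{1}(preimset_imset B phi_inj).
  by rewrite !covS !setD1_notin // andbT.
- move=> adm; have [Be nAe dB dA] := admD _ _ adm.
  have dA' : [disjoint ends e & covered (A :\ e)] by rewrite setD1_notin.
  rewrite /admissible /preimset_pair /= !covS // disjoint_preimset ?vcodom //.
  case/andP: adm; rewrite /admissible /= -{1}(setD1K Be) coveredU => dAB _.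
  by rewrite setD1_notin // (disjointWr _ dAB) // subsetUr.
move=> adm; have [Be nAe dB dA] := admD _ _ adm.
have ABe : e \in A :|: B by rewrite inE Be orbT.
have dAB : [disjoint ends e & covered ((A :|: B) :\ e)].
  rewrite setDUl (setD1_notin nAe) coveredU disjoint_sym.
  by rewrite -setI_eq0 setIUl setU_eq0 !setI_eq0 ![[disjoint _ & ends
    e]]disjoint_sym dA.
rewrite /weight /= (k_extract dAB ABe) (kcov_extract dB Be) -preimsetU subSS.
rewrite (cardsD1 e B) Be -(pre1 B) !(card_preimset_codom phi_inj) ?phiS //.
by rewrite pre1 addnCA add1n subSS exprS; ring.
Qed.

Lemma expansion_rec :
  expansion G = expansion (del_edge e) + y * expansion (contract_edge e)
                + z * expansion (extract_edge e).
Proof.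
rewrite -expansion_del -expansion_contract -expansion_extract /expansion.
rewrite (bigID (fun AB => e \notin AB.1 :|: AB.2)) /= -addrA; congr (_ + _).
rewrite (bigID (fun AB => isolated_in AB.2)) /= addrC; congr (_ + _).
  by apply: eq_bigl => AB; rewrite /contract_adm negbK andbA.
apply: eq_bigl => AB; rewrite negbK -andbA; congr (_ && _).
by apply: andb_idl => /andP[Be _]; rewrite inE Be orbT.
Qed.

End Recurrence.

(** * Multiplicativity over disjoint unions *)

Lemma admissible_disj G H (AB : {set edge (disj_union G H)} * _) :
  admissible AB = admissible (preimset_pair (disj_einl H) AB)
                  && admissible (preimset_pair (disj_einr G) AB).
Proof.
case: AB => A B; rewrite /admissible /preimset_pair /=.
rewrite !covered_disj_inl !covered_disj_inr.
rewrite -!setI_eq0 -!preimsetI;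
  apply/eqP/andP => [-> | [/eqP/setP l0 /eqP/setP r0]].
  by rewrite !preimset0.
by apply/setP => -[v|v]; [have := l0 v | have := r0 v]; rewrite !inE.
Qed.

Lemma expansion_disj G H :
  expansion (disj_union G H) = expansion G * expansion H.
Proof.
rewrite /expansion big_distrlr pair_big /=.
pose pull (AB : {set edge (disj_union G H)} * {set edge (disj_union G H)}) :=
  (preimset_pair (disj_einl H) AB, preimset_pair (disj_einr G) AB).
pose push (P : ({set edge G} * {set edge G}) * ({set edge H} * {set edge H})) :=
  (disj_einl H @: P.1.1 :|: disj_einr G @: P.2.1,
   disj_einl H @: P.1.2 :|: disj_einr G @: P.2.2).
have pushK : cancel push pull.
  case=> [[A B] [C D]]; rewrite /pull /push /preimset_pair /=.
  by rewrite !preimset_disj_inl !preimset_disj_inr.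
apply: (sum_pull pushK) => [[A B] _ | P adm | AB | [A B]].
- by rewrite /push /pull /preimset_pair /= -!disj_setE.
- by rewrite admissible_disj -[preimset_pair _ _]/(pull (push P)).1
             -[preimset_pair (disj_einr G) _]/(pull (push P)).2 pushK.
- by rewrite admissible_disj.
rewrite admissible_disj /weight /= => /andP[adm1 adm2].
(* These bounds make the truncated exponents of the union equal to the sums of those on the two
   sides. *)
have := kcov_le_k adm1; have := kcov_le_k adm2; rewrite /= -!preimsetU.
have := kcov_le_card (disj_einl H @^-1: B).
have := kcov_le_card (disj_einr G @^-1: B).
rewrite (k_disj (A :|: B)) (kcov_disj B) (card_disj A) (card_disj B).
set A1 := disj_einl H @^-1: A; set A2 := disj_einr G @^-1: A.
set B1 := disj_einl H @^-1: B.
set B2 := disj_einr G @^-1: B.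
move: (k (disj_einl H @^-1: _)) (k (disj_einr G @^-1: _)) (kcov B1) (kcov B2)
  #|A1| #|A2| #|B1| #|B2|.
move=> k1 k2 c1 c2 a1 a2 b1 b2 cb2 cb1 ck2 ck1.
have -> : (k1 + k2 - (c1 + c2) = (k1 - c1) + (k2 - c2))%N by lia.
have -> : (a1 + a2 + (b1 + b2) - (c1 + c2) = (a1 + b1 - c1) + (a2 + b2 - c2))%N.
  by lia.
by rewrite !exprD; ring.
Qed.

(** * The expansion of edgeless graphs *)

Lemma k_edgeless (G : mgraph) (S : {set edge G}) : S = set0 -> k S = #|vert G|.
Proof.
move=> ->; rewrite /k /ncomp /n_comp_mem; apply: eq_card => v;
  rewrite !inE andbT.
(* Without edges the path from [v] to its root is empty, so every vertex is a root. *)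
have /connectP[p] := connect_root (adj (set0 : {set edge G})) v.
case: p => [_ /= rv | u p /= /andP[/adjP[f]]]; last by rewrite inE.
exact/eqP.
Qed.

Lemma expansion_edgeless (V : finType) : expansion (edgeless V) = x ^+ #|V|.
Proof.
have all0 (S : {set edge (edgeless V)}) : S = set0 by apply/setP => -[].
rewrite /expansion (big_pred1 (set0, set0)) => [|[A B]].
  rewrite /weight /= k_edgeless ?setU0 // cards0.
  have -> : kcov (set0 : {set edge (edgeless V)}) = 0%N.
    by apply/eqP; rewrite -leqn0 -(@cards0 (edge (edgeless V))) kcov_le_card.
  by rewrite subn0 !expr0 !mulr1.
rewrite (all0 A) (all0 B) /admissible /= /covered big_set0.
by rewrite disjoints_subset sub0set /= eqxx.
Qed.

End Expansion.

(** * Uniqueness of the solution of the axioms *)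

Lemma mgraph_iso_edgeless (G : mgraph) :
  #|edge G| = 0%N -> mgraph_iso G (edgeless 'I_#|vert G|).
Proof.
move=> E0; have noE (f : edge G) : False by have := fintype0 f; rewrite E0.
exists enum_rank, (fun f => match noE f with end); split.
- exact: enum_rank_bij.
(* The two cancellation goals start from an edge of [G] and from an element of [void]; the
   alternative picks the matching contradiction. *)
- by exists (fun f : void => match f with end) => f; case: (noE f) + case: f.
by move=> f; case: (noE f).
Qed.

(** [ord0] becomes the vertex of [E1], and the ordinals lifted past it become the other [n]
    vertices. *)
Lemma mgraph_iso_edgelessS n :
  mgraph_iso (edgeless 'I_n.+1) (disj_union E1 (edgeless 'I_n)).
Proof.
pose fv (i : 'I_n.+1) : unit + 'I_n := if unlift ord0 i is Some j then inr j
  else inl tt.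
pose gv (s : unit + 'I_n) : 'I_n.+1 := if s is inr j then lift ord0 j else ord0.
exists fv, (fun f : void => match f with end); split=> [||[]].
- exists gv => [i | [[]|j]]; rewrite /fv /gv ?unlift_none ?liftK //.
  by case: unliftP.
by exists (fun f => match f with inl f | inr f => f end) => -[] [].
Qed.

Lemma xi_edgeless xi n : is_xi xi -> xi (edgeless 'I_n) = Zx ^+ n.
Proof.
move=> xiP; elim: n => [|n IHn]; last first.
  by rewrite (xi_iso xiP (mgraph_iso_edgelessS n)) (xi_disj xiP) (xi_E1 xiP)
    IHn exprS.
(* For [n = 0], the types ['I_0] and [void] are two presentations of the empty vertex set, so
   isomorphism invariance applies. *)
have no_ord (i : 'I_0) : False by case: i.
rewrite expr0 -(xi_empty xiP); apply: (xi_iso xiP).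
exists (fun i : 'I_0 => match no_ord i with end), id; split=> [||[]].
- exists (fun v : void => match v with end) => i; first by case: (no_ord i).
  by case: i.
by exists id.
Qed.

Lemma xi_unique xi xi' : is_xi xi -> is_xi xi' -> xi =1 xi'.
Proof.
move=> xiP xiP' G; have [n] := ubnP #|edge G|; elim: n G => // n IHn G leG.
have [E0 | /card_gt0P[e _]] := posnP #|edge G|.
  have isoG := mgraph_iso_edgeless E0.
  by rewrite (xi_iso xiP isoG) (xi_iso xiP' isoG) !xi_edgeless.
(* This bound serves deletion and contraction alike, since both have the same edge type. *)
have card_del : (#|{: {f : edge G | f != e}}| < n)%N.
  have lt_del : (#|[pred f | f != e]| < #|edge G|)%N.
    rewrite (cardD1 e (edge G)) add1n ltnS subset_leq_card //.
    by apply/subsetP => f; rewrite !inE andbT.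
  by rewrite card_sig (leq_trans lt_del).
have card_ext : (#|{: {f : edge G | ends f \subset ~: ends e}}| < n)%N.
  apply: leq_ltn_trans card_del; rewrite !card_sig subset_leq_card //.
  (* The set [ends e] is nonempty and so not inside its own complement; hence [e] does not survive
     extraction. *)
  apply/subsetP => f; rewrite !inE; apply: contraTneq => ->.
  rewrite -disjoints_subset -setI_eq0 setIid -card_gt0.
  by case/andP: (ends_card e).
by rewrite (xi_rec xiP e) (xi_rec xiP' e) !IHn.
Qed.

Theorem theorem2 :
  exists xi : mgraph -> {mpoly int[3]},
    [/\ is_xi xi,
        (forall xi' : mgraph -> {mpoly int[3]}, is_xi xi' -> xi' =1 xi)
      & forall G : mgraph,
          xi G =
          \sum_(AB : {set edge G} * {set edge G}
                | [disjoint covered AB.1 & covered AB.2])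
             Zx ^+ (k (AB.1 :|: AB.2) - kcov AB.2)
             * Zy ^+ (#|AB.1| + #|AB.2| - kcov AB.2)
             * Zz ^+ kcov AB.2].
Proof.
have xiP : is_xi (expansion Zx Zy Zz).
  split=> [G H | G e | G H | | ].
  - exact: expansion_iso.
  - exact: expansion_rec.
  - exact: expansion_disj.
  - by rewrite expansion_edgeless card_unit expr1.
  by rewrite expansion_edgeless card_void expr0.
by exists (expansion Zx Zy Zz); split=> // xi' xiP'; apply: xi_unique.
Qed.
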